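(* Let $(M,H)$ be a Hamilton space with Hamiltonian vector field $\rho_H$. (a) If $X\in\mathcal{X}(T^{*}M\setminus\{0\})$ is an exact infinitesimal Noether symmetry of $H$ and $f\in C^\infty(T^{*}M\setminus\{0\})$ is a function with $\mathcal{L}_X\theta=df$, then $f-\theta(X)$ is a conservation law for $H$. (b) Conversely, if $f\in C^\infty(T^{*}M\setminus\{0\})$ is a conservation law for $H$, then the unique solution $X\in\mathcal{X}(T^{*}M\setminus\{0\})$ of the equation $i_X\omega=-df$ is an exact infinitesimal Noether symmetry of $H$.
   Context: Hamilton space: $M$ is a smooth $n$-dimensional manifold and $H:T^{*}M\to\mathbb{R}$ is smooth on $T^{*}M\setminus\{0\}$ (zero section removed), continuous on the zero section, with $g^{ij}=\frac{\partial^2H}{\partial p_i\partial p_j}$ of rank $n$ and constant signature on $T^{*}M\setminus\{0\}$, in induced coordinates $(x^i,p_i)$. All structures are considered on $T^{*}M\setminus\{0\}$. $\theta=p_i\,dx^i$ is the Liouville 1-form and $\omega=d\theta=dp_i\wedge dx^i$ the canonical symplectic form. The Hamiltonian vector field $\rho_H=\frac{\partial H}{\partial p_i}\frac{\partial}{\partial x^i}-\frac{\partial H}{\partial x^i}\frac{\partial}{\partial p_i}$ is determined by $i_{\rho_H}\omega=-dH$. Infinitesimal Noether symmetry of $H$: a vector field $X$ with $\mathcal{L}_X\omega=0$ and $\mathcal{L}_XH=0$; it is exact if the 1-form $\mathcal{L}_X\theta$ is exact. Conservation law (constant of motion) for $H$: a function $f$ with $\mathcal{L}_{\rho_H}f=\rho_H(f)=0$.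 *)

(* Defs.v *)
From HB Require Import structures.
From mathcomp Require Import all_boot all_order all_algebra.
From mathcomp Require Import all_classical all_reals all_analysis.

Set Implicit Arguments.
Unset Strict Implicit.
Unset Printing Implicit Defensive.

Import Order.TTheory GRing.Theory Num.Theory.
Import numFieldNormedType.Exports.

Local Open Scope classical_set_scope.
Local Open Scope ring_scope.

(** ** Smooth functions on open subsets of R^m *)

(* [C_ k U g]: g is of class C^k on the open set U, i.e. continuous if k = 0,
   and differentiable with a derivative (read through the partial derivatives)
   of class C^(k-1) otherwise. *)
Fixpoint C_ (R : realType) (m k : nat) (U : set 'rV[R]_m)
    (g : 'rV[R]_m -> R) : Prop :=
  match k with
  | 0 => forall u, U u -> {for u, continuous g}
  | k'.+1 => (forall u, U u -> differentiable g u) /\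
             forall l : 'I_m, C_ k' U (fun u => 'D_(delta_mx 0 l) g u)
  end.

Definition C_infty (R : realType) (m : nat) (U : set 'rV[R]_m)
  (g : 'rV[R]_m -> R) : Prop := forall k, C_ k U g.

(** ** Charts *)

(* A family of R^m-valued charts on N; [crd i] is only meaningful on [dom i].
   The axioms of an atlas are stated separately, in [smooth_manifold]. *)
Record charts (R : realType) (m : nat) (N : Type) := Charts {
  idx : Type ;
  dom : idx -> set N ;
  crd : idx -> N -> 'rV[R]_m }.

Section charts_theory.
Context {R : realType} {m : nat} {N : Type}.
Variable A : charts R m N.
Implicit Types (i j : idx A) (x : N) (f : N -> R).

Definition img i : set 'rV[R]_m := crd i @` dom i.

(* The expression f o (crd i)^-1 of f in the chart i, extended by 0 outside of
   [img i]. *)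
Definition loc i f : 'rV[R]_m -> R :=
  fun u => xget 0 [set f x | x in [set x | dom i x /\ crd i x = u]].

(* The partial derivative of f with respect to the l-th coordinate of i. *)
Definition pd i (l : 'I_m) f : N -> R :=
  fun x => 'D_(delta_mx 0 l) (loc i f) (crd i x).

(* The entry (k, l) is the derivative of the l-th coordinate of j with respect
   to the k-th coordinate of i. *)
Definition jac i j x : 'M[R]_m :=
  \matrix_(k, l) pd i k (fun y => crd j y 0 l) x.

Definition smooth f : Prop := forall i, C_infty (img i) (loc i f).

(** ** Tensor fields, given by their components in all charts *)

(* To make Leibniz equality of fields the right one, the components in the
   chart i vanish outside of [dom i]. *)
Definition on (V : nmodType) (T : idx A -> N -> V) : idx A -> N -> V :=
  fun i => patch (fun=> 0) (dom i) (T i).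

Record vector_field (X : idx A -> N -> 'rV[R]_m) : Prop := VectorField {
  vector_field_out : forall i x, ~ dom i x -> X i x = 0 ;
  vector_field_change : forall i j x, dom i x -> dom j x ->
    X j x = X i x *m jac i j x ;
  vector_field_smooth : forall i (l : 'I_m),
    C_infty (img i) (loc i (fun x => X i x 0 l)) }.

(* alpha(X), whose value at x is computed in any chart at x. *)
Definition pairing (alpha X : idx A -> N -> 'rV[R]_m) : N -> R :=
  fun x => xget 0 [set \sum_l alpha i x 0 l * X i x 0 l | i in
                    [set i | dom i x]].

Definition d0 f : idx A -> N -> 'rV[R]_m :=
  on (fun i x => \row_l pd i l f x).

(* A 2-form is given by its matrix of components
   beta_kl = beta(\partial_k, \partial_l). *)
Definition d1 (alpha : idx A -> N -> 'rV[R]_m) : idx A -> N -> 'M[R]_m :=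
  on (fun i x => \matrix_(k, l)
    (pd i k (fun y => alpha i y 0 l) x - pd i l (fun y => alpha i y 0 k) x)).

Definition iprod (X : idx A -> N -> 'rV[R]_m)
    (beta : idx A -> N -> 'M[R]_m) : idx A -> N -> 'rV[R]_m :=
  fun i x => X i x *m beta i x.

(* Lie derivatives: the coordinate expressions of the derivative at t = 0 of
   the pull-back by the flow of X; Cartan's formula is not built in. *)

Definition lie0 (X : idx A -> N -> 'rV[R]_m) f : N -> R := pairing (d0 f) X.

Definition lie1 (X alpha : idx A -> N -> 'rV[R]_m) : idx A -> N -> 'rV[R]_m :=
  on (fun i x => \row_l \sum_s
    (X i x 0 s * pd i s (fun y => alpha i y 0 l) x +
     alpha i x 0 s * pd i l (fun y => X i y 0 s) x)).

Definition lie2 (X : idx A -> N -> 'rV[R]_m) (beta : idx A -> N -> 'M[R]_m) :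
    idx A -> N -> 'M[R]_m :=
  on (fun i x => \matrix_(k, l) \sum_s
    (X i x 0 s * pd i s (fun y => beta i y k l) x +
     beta i x s l * pd i k (fun y => X i y 0 s) x +
     beta i x k s * pd i l (fun y => X i y 0 s) x)).

Definition exact1 (alpha : idx A -> N -> 'rV[R]_m) : Prop :=
  exists2 g, smooth g & alpha = d0 g.

End charts_theory.

Arguments d0 {R m N A} f.

Record smooth_manifold (R : realType) (n : nat) (M : topologicalType)
    (A : charts R n M) : Prop := SmoothManifold {
  manifold_hausdorff : hausdorff_space M ;
  manifold_second_countable : @second_countable M ;
  chart_cover : forall x : M, exists i : idx A, dom i x ;
  chart_dom_open : forall i : idx A, open (dom i) ;
  chart_img_open : forall i : idx A, open (img i) ;
  chart_inj : forall i : idx A, set_inj (dom i) (crd i) ;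
  chart_continuous : forall (i : idx A) (x : M), dom i x ->
    {for x, continuous (crd i)} ;
  chart_open_map : forall (i : idx A) (U : set M),
    open U -> U `<=` dom i -> open (crd i @` U) ;
  chart_smooth : forall (i j : idx A) (l : 'I_n),
    C_infty (crd i @` (dom i `&` dom j)) (loc i (fun x => crd j x 0 l)) }.

(** ** The cotangent bundle *)

Section cotangent.
Context {R : realType} {n : nat} {M : Type}.
Variable A : charts R n M.

(* A covector p at the point [base] is given by its components in all charts i
   at this point (by 0 in the other ones); with x the coordinates of i and y
   those of j, they change by p_k = p'_l * (dy^l / dx^k). *)
Record cotangent := Cotangent {
  base : M ;
  mom : idx A -> 'rV[R]_n ;
  mom_out : forall i, ~ dom i base -> mom i = 0 ;
  mom_change : forall i j, dom i base -> dom j base ->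
    mom i = mom j *m (jac i j base)^T }.

(* The induced coordinates (x^1, ..., x^n, p_1, ..., p_n). *)
Definition cot_charts : charts R (n + n) cotangent := {|
  idx := idx A ;
  dom := fun i => [set a | dom i (base a)] ;
  crd := fun i a => row_mx (crd i (base a)) (mom a i) |}.

Definition zero_section : set cotangent := [set a | mom a = fun=> 0].

Definition slit := {a : cotangent | ~ zero_section a}.

Definition slit_charts : charts R (n + n) slit := {|
  idx := idx A ;
  dom := fun i => [set a | dom i (base (sval a))] ;
  crd := fun i a => row_mx (crd i (base (sval a))) (mom (sval a) i) |}.

(* p_k dx^k *)
Definition liouville : idx slit_charts -> slit -> 'rV[R]_(n + n) :=
  on (fun (i : idx slit_charts) a => row_mx (mom (sval a) i) 0).

Definition symplectic : idx slit_charts -> slit -> 'M[R]_(n + n) :=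
  d1 liouville.

End cotangent.

Notation "'theta_[' A ]" := (@liouville _ _ _ A) (format "'theta_[' A ]").
Notation "'omega_[' A ]" := (@symplectic _ _ _ A) (format "'omega_[' A ]").

(** ** Hamilton spaces *)

(* Sylvester normal form: r positive and s negative squares. *)
Definition has_signature (R : realType) (n : nat) (S : 'M[R]_n)
    (r s : nat) : Prop :=
  (r + s <= n)%N /\
  exists2 P, P \in unitmx & P *m S *m P^T =
    diag_mx (\row_k (if (k < r)%N then 1 else if (k < r + s)%N then -1 else 0)).

Section hamilton.
Context {R : realType} {n : nat} {M : Type} {A : charts R n M}.
Implicit Types (i : idx (slit_charts A)) (a : slit A).
Variable H : cotangent A -> R.

Definition slit_restr : slit A -> R := fun a => H (sval a).

(* g^kl = d^2 H / dp_k dp_l *)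
Definition hamilton_metric i a : 'M[R]_n :=
  \matrix_(k, l) pd i (rshift n k) (pd i (rshift n l) slit_restr) a.

Record hamilton_space : Prop := HamiltonSpace {
  hamilton_smooth : smooth (slit_charts A) slit_restr ;
  hamilton_continuous : forall (i : idx (cot_charts A)) (z : cotangent A),
    dom i z -> zero_section z -> {for crd i z, continuous (loc i H)} ;
  hamilton_rank : forall i a, dom i a -> \rank (hamilton_metric i a) = n ;
  hamilton_signature : exists r s : nat, forall i a, dom i a ->
    has_signature (hamilton_metric i a) r s }.

(* rho_H = (dH / dp_k) (d / dx^k) - (dH / dx^k) (d / dp_k) *)
Definition hamiltonian_field : idx (slit_charts A) -> slit A -> 'rV[R]_(n + n) :=
  on (fun i a => row_mx (\row_k pd i (rshift n k) slit_restr a)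
                        (\row_k - pd i (lshift n k) slit_restr a)).

Definition noether_symmetry (X : idx (slit_charts A) -> slit A -> 'rV[R]_(n + n)) :
    Prop :=
  [/\ vector_field X, lie2 X omega_[A] = 0 & lie0 X slit_restr = 0].

Definition exact_noether_symmetry
    (X : idx (slit_charts A) -> slit A -> 'rV[R]_(n + n)) : Prop :=
  noether_symmetry X /\ exact1 (lie1 X theta_[A]).

Definition conservation_law (f : slit A -> R) : Prop :=
  smooth (slit_charts A) f /\ lie0 hamiltonian_field f = 0.

End hamilton.

(* Main.v *)
Require Import Defs.
From mathcomp Require Import all_boot all_order all_algebra.
From mathcomp Require Import all_classical all_reals all_analysis.
From mathcomp Require Import ring lra.

Set Implicit Arguments.
Unset Strict Implicit.
Unset Printing Implicit Defensive.

Import Order.TTheory GRing.Theory Num.Theory.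
Import numFieldNormedType.Exports.

Local Open Scope classical_set_scope.
Local Open Scope ring_scope.

(** In canonical coordinates the symplectic form is the constant matrix
    [darboux], so that X |-> i_X omega is a linear isomorphism between vector
    fields and 1-forms, whose inverse sends - df to the [symplectic_gradient]
    of f; rho_H is the symplectic gradient of H. Two identities then carry the
    whole correspondence between symmetries and conservation laws:
    - Cartan's formula L_X theta = d(theta(X)) + i_X omega ([lie1_liouville]);
    - if i_X omega = dh, then rho_H(h) = omega(X, rho_H) = X(H)
      ([lie0_hamiltonian]).

    For (a), L_X theta = df and Cartan's formula give
    i_X omega = d(f - theta(X)), whence rho_H(f - theta(X)) = X(H) = 0.

    For (b), X has to be the symplectic gradient of f. It preserves omega, since
    L_X omega = d(i_X omega) = - d(df) = 0, and it preserves H because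
    i_X omega = d(- f) gives X(H) = - rho_H(f) = 0. Finally
    L_X theta = d(theta(X)) - df is the differential of theta(X) - f.

    The work lies in what makes these computations chart-independent. A value
    such as alpha(X) is read in an arbitrary chart, so one needs the change of
    coordinates of 1-forms, which is the chain rule ([pd_change]). That the
    symplectic gradient is a vector field, and that omega has the same matrix in
    all the induced charts, means that the Jacobian matrices of the induced
    changes of coordinates are symplectic ([jac_symplectic]). They are block
    triangular, and their off-diagonal block involves the second derivatives of
    a change of coordinates of M; the symplectic relation for this block
    ([slit_jac]) is their symmetry ([schwarz]). *)

(** * Differential calculus on open subsets of R^m *)

Section calculus.
Context {R : realType}.
Implicit Types m n : nat.

(** Allows one to replace a chart expression by a more convenient one that agrees
    with it only near the point. *)
Lemma near_eq_differentiable m (f g : 'rV[R]_m -> R) (u : 'rV[R]_m) :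
  (\near u, f u = g u) -> differentiable f u -> differentiable g u.
Proof.
move=> fg /[dup] df' /diff_locallyP[df fE].
have fgu : f u = g u by exact: nbhs_singleton fg.
have gE : g \o shift u = (cst (g u) : 'rV[R]_m -> R) + ('d f u : 'rV[R]_m -> R)
    +o_ (0 : 'rV[R]_m) id.
  apply/eqaddoP => e e0; have /eqaddoP/(_ e e0) := fE.
  move=> H; near=> h.
  have fgh : f (h + u) = g (h + u).
    by near: h; move: fg; rewrite (near_shift 0 u)/= subr0.
  suff -> : (g \o shift u - (cst (g u) + 'd f u)) h =
            (f \o shift u - (cst (f u) + 'd f u)) h by near: h.
  by rewrite /= !fctE /= fgh fgu.
have dgE : 'd g u = 'd f u :> ('rV[R]_m -> R) by exact: diff_unique.
by apply/diff_locallyP; rewrite dgE.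
Unshelve. all: by end_near. Qed.

Lemma derive_row m (g : 'rV[R]_m -> R) (u v : 'rV[R]_m) : differentiable g u ->
  'D_v g u = \sum_l v 0 l * 'D_(delta_mx 0 l) g u.
Proof.
move=> dg; rewrite deriveE// {1}[v]row_sum_delta linear_sum/=.
by apply: eq_bigr => l _; rewrite linearZ /= deriveE.
Qed.

Lemma differentiable_row m n (F : 'rV[R]_m -> 'rV[R]_n) (u : 'rV[R]_m) :
  (forall l, differentiable (fun v => F v 0 l) u) -> differentiable F u.
Proof.
move=> dF.
rewrite (_ : F = \sum_(l < n) (fun v => F v 0 l *: delta_mx 0 l)).
  by apply: differentiable_sum => l; exact: differentiableZl.
by apply/funext => v; rewrite {1}[F v]row_sum_delta fct_sumE.
Qed.

Lemma derive_comp m n (F : 'rV[R]_m -> 'rV[R]_n) (g : 'rV[R]_n -> R)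
    (u v : 'rV[R]_m) :
  (forall l, differentiable (fun w => F w 0 l) u) -> differentiable g (F u) ->
  'D_v (g \o F) u =
  \sum_l 'D_v (fun w => F w 0 l) u * 'D_(delta_mx 0 l) g (F u).
Proof.
move=> dF' dg; have dF := differentiable_row dF'.
rewrite deriveE; last exact: differentiable_comp.
rewrite diff_comp //= -deriveE // -deriveE// derive_row //.
apply: eq_bigr => l _; congr (_ * _).
by rewrite derive_mx ?mxE//; exact: diff_derivable.
Qed.

Lemma derive_coord m (u v : 'rV[R]_m) l : 'D_v (fun w : 'rV[R]_m => w 0 l) u = v 0 l.
Proof.
by rewrite -[in RHS](@derive_id R _ u v) derive_mx ?mxE//; exact: derivable_id.
Qed.

Section open_set.
Variables (m : nat) (U : set 'rV[R]_m).
Hypothesis openU : open U.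
Implicit Types f g : 'rV[R]_m -> R.

Lemma near_eq_in f g u : U u -> (forall v, U v -> f v = g v) -> \near u, f u = g u.
Proof. by move=> Uu fg; apply: filterS (open_nbhs_nbhs (conj openU Uu)). Qed.

(** Being C^k on an open set is a local property: chart expressions may be
    replaced by formulas that are valid on the image of the chart only. *)
Lemma C_eq k f g : (forall u, U u -> f u = g u) -> C_ k U f -> C_ k U g.
Proof.
elim: k f g => [|k IHk] f g fg /=.
  move=> fc u Uu; have /= := fc u Uu.
  rewrite /prop_for /continuous_at (fg _ Uu); apply: cvg_trans.
  exact: (@near_eq_cvg _ _ (nbhs u) _ _ _ (near_eq_in Uu fg)).
move=> [df Df]; split=> [u Uu|l].
  exact: near_eq_differentiable (near_eq_in Uu fg) (df u Uu).
by apply: IHk (Df l) => u Uu; apply: near_eq_derive; exact: near_eq_in fg.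
Qed.

Lemma C_prev k f : C_ k.+1 U f -> C_ k U f.
Proof.
elim: k f => [|k IHk] f [df Df].
  by move=> u Uu; apply: differentiable_continuous; exact: df.
by split=> // l; exact: IHk.
Qed.

Lemma C_const k (c : R) : C_ k U (cst c).
Proof.
elim: k c => [|k IHk] c /=; first by move=> u _; exact: cst_continuous.
split=> [//|l]; rewrite (_ : (fun u => _) = cst 0); first exact: IHk.
by apply/funext => u; rewrite derive_cst.
Qed.

Lemma C_coord k l : C_ k U (fun u => u 0 l).
Proof.
case: k => [|k]; first by move=> u _ /=; exact: coord_continuous.
split=> [u _|j]; first exact: differentiable_coord.
by apply: C_eq (C_const k (delta_mx 0 j 0 l : R)) => u _; rewrite derive_coord.
Qed.

Lemma C_add k f g : C_ k U f -> C_ k U g -> C_ k U (f + g).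
Proof.
elim: k f g => [|k IHk] f g.
  by move=> fc gc u Uu; exact: continuousD (fc _ _) (gc _ _).
move=> [df Df] [dg Dg]; split=> [u Uu|l]; first exact: differentiableD (df _ _) (dg _ _).
apply: C_eq (IHk _ _ (Df l) (Dg l)) => u Uu.
by rewrite deriveD//; apply: diff_derivable; [exact: df|exact: dg].
Qed.

Lemma C_opp k f : C_ k U f -> C_ k U (- f).
Proof.
elim: k f => [|k IHk] f; first by move=> fc u Uu; exact: continuousN (fc _ _).
move=> [df Df]; split=> [u Uu|l]; first exact: differentiableN (df _ _).
apply: C_eq (IHk _ (Df l)) => u Uu.
by rewrite deriveN//; apply: diff_derivable; exact: df.
Qed.

Lemma C_mul k f g : C_ k U f -> C_ k U g -> C_ k U (f * g).
Proof.
elim: k f g => [|k IHk] f g.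
  by move=> fc gc u Uu; exact: continuousM (fc _ _) (gc _ _).
move=> Cf Cg; have [df Df] := Cf; have [dg Dg] := Cg.
split=> [u Uu|l]; first exact: differentiableM (df _ _) (dg _ _).
apply: C_eq (C_add (IHk _ _ (C_prev Cf) (Dg l)) (IHk _ _ (C_prev Cg) (Df l))) => u Uu.
by rewrite deriveM//; apply: diff_derivable; [exact: df|exact: dg].
Qed.

Lemma C_infty_sum (I : Type) (r : seq I) (F : I -> 'rV[R]_m -> R) :
  (forall i, C_infty U (F i)) -> C_infty U (\sum_(i <- r) F i).
Proof.
move=> CF k; apply: (big_ind (C_ k U)) => [|f g|i _].
- exact: C_const.
- exact: C_add.
- exact: CF.
Qed.

Lemma C_infty_derive f l : C_infty U f -> C_infty U (fun u => 'D_(delta_mx 0 l) f u).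
Proof. by move=> Cf k; have [_] := Cf k.+1; exact. Qed.

Lemma C_infty_differentiable f u : C_infty U f -> U u -> differentiable f u.
Proof. by move=> Cf; have [df _] := Cf 1%N; exact: df. Qed.


End open_set.

Lemma is_derive_line m (G : 'rV[R]_m -> R) (v w : 'rV[R]_m) (s : R) :
  differentiable G (s *: v + w) ->
  is_derive s 1 (fun t : R => G (t *: v + w)) ('D_v G (s *: v + w)).
Proof.
move=> dG; have E :
  (fun h : R => h^-1 *: (G ((h *: (1 : R) + s) *: v + w) - G (s *: v + w))) =
  (fun h : R => h^-1 *: (G (h *: v + (s *: v + w)) - G (s *: v + w))).
  by apply/funext => h; rewrite /= [h *: 1]mulr1 scalerDl addrA.
have := @diff_derivable _ _ _ _ _ v dG; rewrite /derivable -E => dGv.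
by apply: DeriveDef => //; rewrite /derive E.
Qed.

(** The second difference of g over a parallelogram is the increment of
    s |-> g(s e_k + h e_l + u) - g(s e_k + u) between 0 and h: one use of the mean
    value theorem in the direction k and a second one in the direction l turn it
    into a mixed derivative at an intermediate point. *)
Lemma mean_value_second m (U : set 'rV[R]_m) (g : 'rV[R]_m -> R) k l u (h : R) :
  C_ 2 U g -> 0 < h ->
  (forall s t, 0 <= s <= h -> 0 <= t <= h ->
     U (s *: delta_mx 0 k + (t *: delta_mx 0 l + u))) ->
  exists2 c : R * R, (0 <= c.1 <= h) && (0 <= c.2 <= h) &
    g (h *: delta_mx 0 k + (h *: delta_mx 0 l + u)) - g (h *: delta_mx 0 k + u)
    - (g (h *: delta_mx 0 l + u) - g u) =
    'D_(delta_mx 0 l) (fun v => 'D_(delta_mx 0 k) g v)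
      (c.1 *: delta_mx 0 k + (c.2 *: delta_mx 0 l + u)) * h * h.
Proof.
move=> [dg Dg] h0 Uh; have [dDg _] := Dg k.
have h00 : 0 <= (0 : R) <= h by apply/andP; split=> //; exact: ltW.
have hh : 0 <= h <= h by apply/andP; split=> //; exact: ltW.
pose phi (s : R) :=
  g (s *: delta_mx 0 k + (h *: delta_mx 0 l + u)) - g (s *: delta_mx 0 k + u).
pose dphi (s : R) := 'D_(delta_mx 0 k) g (s *: delta_mx 0 k + (h *: delta_mx 0 l + u))
  - 'D_(delta_mx 0 k) g (s *: delta_mx 0 k + u).
have dphiP s : 0 <= s <= h -> is_derive s 1 phi (dphi s).
  move=> s0h; apply: is_deriveB; apply: is_derive_line; apply: dg; first exact: Uh.
  by have := Uh s 0 s0h h00; rewrite scale0r add0r.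
have [c1 c1h E1] : exists2 c1, 0 <= c1 <= h & phi h - phi 0 = dphi c1 * h.
  have [||c] := @MVT _ phi dphi 0 h h0.
  - by move=> s; rewrite in_itv /= => /andP[? ?]; apply: dphiP; rewrite !ltW.
  - apply: derivable_within_continuous => s; rewrite in_itv /= => s0h.
    by have [] := dphiP _ s0h.
  - by rewrite in_itv /= subr0 => /andP[? ?]; exists c => //; rewrite !ltW.
pose psi (t : R) := 'D_(delta_mx 0 k) g (t *: delta_mx 0 l + (c1 *: delta_mx 0 k + u)).
pose dpsi (t : R) := 'D_(delta_mx 0 l) (fun v => 'D_(delta_mx 0 k) g v)
  (t *: delta_mx 0 l + (c1 *: delta_mx 0 k + u)).
have dpsiP t : 0 <= t <= h -> is_derive t 1 psi (dpsi t).
  move=> t0h; apply: (@is_derive_line _ (fun v => 'D_(delta_mx 0 k) g v)); apply: dDg.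
  by rewrite addrCA; exact: Uh.
have [c2 c2h E2] : exists2 c2, 0 <= c2 <= h & psi h - psi 0 = dpsi c2 * h.
  have [||c] := @MVT _ psi dpsi 0 h h0.
  - by move=> s; rewrite in_itv /= => /andP[? ?]; apply: dpsiP; rewrite !ltW.
  - apply: derivable_within_continuous => s; rewrite in_itv /= => s0h.
    by have [] := dpsiP _ s0h.
  - by rewrite in_itv /= subr0 => /andP[? ?]; exists c => //; rewrite !ltW.
exists (c1, c2); first by rewrite c1h c2h.
have Ep : psi h - psi 0 = dphi c1.
  by rewrite /psi /dphi scale0r add0r (addrCA (h *: delta_mx 0 l)).
transitivity (dpsi c2 * h * h); first by rewrite -E2 Ep -E1 /phi scale0r !add0r.
by rewrite /dpsi /= (addrCA (c2 *: delta_mx 0 l)).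
Qed.

Lemma continuous_ball m (F : 'rV[R]_m -> R) u e : {for u, continuous F} -> 0 < e ->
  exists2 r, 0 < r & forall y, `|y - u| < r -> `|F u - F y| < e.
Proof.
move=> /cvgrPdist_lt/[apply] /nbhs_ballP[r r0 rP]; exists r => // y yu.
by apply: rP; rewrite -ball_normE /= distrC.
Qed.

(** The second difference is symmetric in the two directions, so both mixed
    derivatives take a common value near u, at possibly different points; they
    agree at u by continuity. *)
Lemma schwarz m (U : set 'rV[R]_m) (g : 'rV[R]_m -> R) k l u :
  open U -> C_ 2 U g -> U u ->
  'D_(delta_mx 0 l) (fun v => 'D_(delta_mx 0 k) g v) u =
  'D_(delta_mx 0 k) (fun v => 'D_(delta_mx 0 l) g v) u.
Proof.
move=> openU Cg Uu; have [dg Dg] := Cg.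
pose Dkl v := 'D_(delta_mx 0 l) (fun w => 'D_(delta_mx 0 k) g w) v.
pose Dlk v := 'D_(delta_mx 0 k) (fun w => 'D_(delta_mx 0 l) g w) v.
rewrite -[LHS]/(Dkl u) -[RHS]/(Dlk u).
have ck : {for u, continuous Dkl} by have [_ /(_ l) /(_ u Uu)] := Dg k.
have cl : {for u, continuous Dlk} by have [_ /(_ k) /(_ u Uu)] := Dg l.
apply/eqP; rewrite -subr_eq0 -normr_le0; apply/ler_addgt0Pl => e e0; rewrite addr0.
have e20 : 0 < e / 2 by rewrite divr_gt0.
have [r1 r10 H1] := continuous_ball ck e20.
have [r2 r20 H2] := continuous_ball cl e20.
have [r3 /= r30 H3] : exists2 r, 0 < r & forall y, `|y - u| < r -> U y.
  have /nbhs_ballP[r r0 rP] := open_nbhs_nbhs (conj openU Uu); exists r => // y yu.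
  by apply: rP; rewrite -ball_normE /= distrC.
have [r [r0 Hr]] : exists r, 0 < r /\ forall y, `|y - u| < r ->
    [/\ U y, `|Dkl u - Dkl y| < e / 2 & `|Dlk u - Dlk y| < e / 2].
  exists (Num.min r1 (Num.min r2 r3)); split; first by rewrite !lt_min r10 r20.
  by move=> y; rewrite !lt_min => /and3P[yr1 yr2 yr3]; split;
    [exact: H3|exact: H1|exact: H2].
(* A parallelogram of sides r / 4 lies in the ball of radius r around u. *)
have dn (i : 'I_m) : `|delta_mx 0 i : 'rV[R]_m| <= 1.
  rewrite [leLHS]/Num.Def.normr/= mx_normrE bigmax_le// => -[a b] _ /=.
  by rewrite mxE; case: (_ && _); rewrite ?normr1 ?normr0.
have near_u i j s t : 0 <= s <= r / 4 -> 0 <= t <= r / 4 ->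
    `|s *: delta_mx 0 i + (t *: delta_mx 0 j + u) - u| < r.
  move=> /andP[s0 sr] /andP[t0 tr]; rewrite addrA addrK.
  apply: le_lt_trans (ler_normD _ _) _; rewrite !normrZ !ger0_norm//.
  have := ler_wpM2l s0 (dn i); have := ler_wpM2l t0 (dn j); lra.
have h0 : 0 < r / 4 by rewrite divr_gt0.
have Uh i j s t : 0 <= s <= r / 4 -> 0 <= t <= r / 4 ->
    U (s *: delta_mx 0 i + (t *: delta_mx 0 j + u)).
  by move=> sr tr; have [] := Hr _ (near_u i j s t sr tr).
have [c /andP[c1 c2] Ec] := mean_value_second Cg h0 (Uh k l).
have [d /andP[d1 d2] Ed] := mean_value_second Cg h0 (Uh l k).
have [_ /ltW + _] := Hr _ (near_u k l _ _ c1 c2).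
have [_ _ /ltW] := Hr _ (near_u l k _ _ d1 d2).
rewrite -[X in _ = X * _ * _]/(Dkl _) in Ec.
rewrite -[X in _ = X * _ * _]/(Dlk _) in Ed.
move: (Dkl u) (Dlk u) (Dkl _) (Dlk _) Ec Ed => a b q p Ec Ed bp aq.
have pq : q = p.
  have hn0 : r / 4 != 0 by rewrite gt_eqF.
  apply: (mulIf hn0); apply: (mulIf hn0); rewrite -Ec -Ed.
  by rewrite (addrCA (_ *: delta_mx 0 l)); ring.
rewrite (_ : a - b = (a - q) - (b - p)); last by rewrite pq; ring.
by apply: le_trans (ler_normB _ _) _; rewrite [leRHS]splitr lerD.
Qed.

End calculus.

(** * Calculus in the charts of an atlas *)

(** The two properties below are all that calculus in charts uses. They are
    separated from [smooth_manifold] because they have to be established for the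
    induced charts of the cotangent bundle as well, and in two steps: the
    differentiability of the induced changes of coordinates is itself proved by
    calculus in charts, once the induced charts are known to be open. *)
Record open_atlas (R : realType) (m : nat) (N : Type) (A : charts R m N) :
    Prop := OpenAtlas {
  atlas_inj : forall i : idx A, set_inj (dom i) (crd i) ;
  atlas_open : forall i j : idx A, open (crd i @` (dom i `&` dom j)) }.

Arguments atlas_open {R m N A} _ i j.

Definition differentiable_transitions (R : realType) (m : nat) (N : Type)
    (A : charts R m N) : Prop :=
  forall (i j : idx A) (x : N) (l : 'I_m), dom i x -> dom j x ->
    differentiable (loc i (fun y => crd j y 0 l)) (crd i x).

Section atlas.
Context {R : realType} {m : nat} {N : Type} {A : charts R m N}.
Hypothesis A_open : open_atlas A.
Implicit Types (i j : idx A) (x : N) (f g : N -> R) (k l : 'I_m).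

Definition diff_at i f x := differentiable (loc i f) (crd i x).

Lemma loc_crd i f x : dom i x -> loc i f (crd i x) = f x.
Proof.
move=> ix; apply: xget_unique; first by exists x.
move=> _ [y [iy yx] <-]; congr (f _).
by apply: (atlas_inj A_open) yx; rewrite inE.
Qed.

Lemma loc_out i f u : ~ img i u -> loc i f u = 0.
Proof.
by move=> iu; apply: xgetPN => _ [x [ix xu] _]; apply: iu; exists x.
Qed.

(** An equality of functions on all of R^m, and not only on the image of the
    chart, because [loc] extends by 0; likewise for the algebraic rules below. *)
Lemma eq_loc i f g : (forall x, dom i x -> f x = g x) -> loc i f = loc i g.
Proof.
move=> fg; apply/funext => u; have [[x ix <-]|iu] := pselect (img i u).
  by rewrite !loc_crd// fg.
by rewrite !loc_out.
Qed.

Lemma eq_pd i k f g x : (forall x, dom i x -> f x = g x) -> pd i k f x = pd i k g x.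
Proof. by move=> fg; rewrite /pd (eq_loc fg). Qed.

Lemma img_open i : open (img i).
Proof. by have := atlas_open A_open i i; rewrite setIid. Qed.

(** The overlap of two charts being open, a derivative at one of its points may be
    computed from a formula that is valid on the overlap only. *)
Lemma overlap_near i j x (P : set 'rV[R]_m) : dom i x -> dom j x ->
  (forall y, dom i y -> dom j y -> P (crd i y)) -> \forall u \near crd i x, P u.
Proof.
move=> ix jx ijP; suff : nbhs (crd i x) P by [].
have ijx : (crd i @` (dom i `&` dom j)) (crd i x) by exists x.
apply: filterS (open_nbhs_nbhs (conj (atlas_open A_open i j) ijx)).
by move=> _ [y [iy jy] <-]; exact: ijP.
Qed.

Lemma overlap_eq i j f g x : dom i x -> dom j x ->
  (forall y, dom i y -> dom j y -> f y = g y) ->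
  \forall u \near crd i x, loc i f u = loc i g u.
Proof.
move=> ix jx fg; apply: (overlap_near ix jx) => y iy jy.
by rewrite !loc_crd// fg.
Qed.

Lemma overlap_pd i j k f g x : dom i x -> dom j x ->
  (forall y, dom i y -> dom j y -> f y = g y) -> pd i k f x = pd i k g x.
Proof. by move=> ix jx fg; apply: near_eq_derive; exact: overlap_eq fg. Qed.

Lemma overlap_diff_at i j f g x : dom i x -> dom j x ->
  (forall y, dom i y -> dom j y -> f y = g y) -> diff_at i f x -> diff_at i g x.
Proof. by move=> ix jx fg; apply: near_eq_differentiable; exact: overlap_eq fg. Qed.

Lemma locB i f g : loc i (f - g) = loc i f - loc i g.
Proof.
apply/funext => u; have [[x ix <-]|iu] := pselect (img i u).
  by rewrite !fctE !loc_crd.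
by rewrite -[RHS]/(loc i f u - loc i g u) !loc_out// subr0.
Qed.

Lemma pdB i k f g x : diff_at i f x -> diff_at i g x ->
  pd i k (f - g) x = pd i k f x - pd i k g x.
Proof. by move=> df dg; rewrite /pd locB deriveB//; exact: diff_derivable. Qed.

Lemma locN i f : loc i (- f) = - loc i f.
Proof.
apply/funext => u; have [[x ix <-]|iu] := pselect (img i u).
  by rewrite !fctE !loc_crd.
by rewrite -[RHS]/(- loc i f u) !loc_out// oppr0.
Qed.

Lemma pdN i k f x : diff_at i f x -> pd i k (- f) x = - pd i k f x.
Proof. by move=> df; rewrite /pd locN deriveN//; exact: diff_derivable. Qed.

Lemma loc_sumM n (f g : 'I_n -> N -> R) i :
  loc i (fun y => \sum_s f s y * g s y) = \sum_s (loc i (f s) * loc i (g s)).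
Proof.
apply/funext => u; rewrite fct_sumE; have [[x ix <-]|iu] := pselect (img i u).
  rewrite loc_crd//; apply: eq_bigr => s _.
  by rewrite -[RHS]/(loc i (f s) _ * loc i (g s) _) !loc_crd.
by rewrite loc_out// big1// => s _; rewrite fctE !loc_out// mulr0.
Qed.

Lemma diff_at_sumM n (f g : 'I_n -> N -> R) i x :
  (forall s, diff_at i (f s) x) -> (forall s, diff_at i (g s) x) ->
  diff_at i (fun y => \sum_s f s y * g s y) x.
Proof.
move=> df dg; rewrite /diff_at loc_sumM; apply: differentiable_sum => s.
exact: differentiableM (df s) (dg s).
Qed.

Lemma pd_sumM n (f g : 'I_n -> N -> R) i k x : dom i x ->
  (forall s, diff_at i (f s) x) -> (forall s, diff_at i (g s) x) ->
  pd i k (fun y => \sum_s f s y * g s y) x =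
  \sum_s (pd i k (f s) x * g s x + f s x * pd i k (g s) x).
Proof.
move=> ix df dg; rewrite /pd loc_sumM derive_sum; last first.
  by move=> s; apply: diff_derivable; exact: differentiableM (df s) (dg s).
apply: eq_bigr => s _.
have dfv := @diff_derivable _ _ _ _ _ (delta_mx 0 k) (df s).
have dgv := @diff_derivable _ _ _ _ _ (delta_mx 0 k) (dg s).
rewrite (deriveM dfv dgv) !(loc_crd _ ix) addrC; congr (_ + _).
exact: mulrC.
Qed.

Lemma pd_crd i k l x : dom i x -> pd i k (fun y => crd i y 0 l) x = (k == l)%:R.
Proof.
move=> ix; rewrite /pd.
transitivity ('D_(delta_mx 0 k) (fun u : 'rV[R]_m => u 0 l) (crd i x)).
  by apply: near_eq_derive; apply: (overlap_near ix ix) => y iy _; rewrite loc_crd.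
by rewrite derive_coord mxE eqxx eq_sym.
Qed.

Lemma diff_at_crd i l x : dom i x -> diff_at i (fun y => crd i y 0 l) x.
Proof.
move=> ix; apply: (@near_eq_differentiable _ _ (fun u : 'rV[R]_m => u 0 l)).
  by apply: (overlap_near ix ix) => y iy _; rewrite loc_crd.
exact: differentiable_coord.
Qed.

Lemma diff_at_cst i c x : dom i x -> diff_at i (fun=> c) x.
Proof.
move=> ix; apply: (@near_eq_differentiable _ _ (cst c)); last exact: differentiable_cst.
by apply: (overlap_near ix ix) => y iy _; rewrite loc_crd.
Qed.

Lemma pd_cst i k c x : dom i x -> pd i k (fun=> c) x = 0.
Proof.
move=> ix; rewrite -(derive_cst c (crd i x) (delta_mx 0 k)).
by apply: near_eq_derive; apply: (overlap_near ix ix) => y iy _; rewrite loc_crd.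
Qed.

Hypothesis A_diff : differentiable_transitions A.

(** The expressions of f in two charts differ by the change of coordinates; the
    chain rule for this composition gives the next transformation rules. *)
Lemma change_near i j f x : dom i x -> dom j x ->
  \forall u \near crd i x,
    (loc j f \o (fun u => \row_l loc i (fun y => crd j y 0 l) u)) u = loc i f u.
Proof.
move=> ix jx; apply: (overlap_near ix jx) => y iy jy /=.
rewrite [X in loc j f X](_ : _ = crd j y) ?loc_crd//.
by apply/rowP => l; rewrite mxE loc_crd.
Qed.

Lemma change_diff i j x l : dom i x -> dom j x ->
  differentiable
    (fun u => (\row_l loc i (fun y => crd j y 0 l) u : 'rV[R]_m) 0 l) (crd i x).
Proof.
move=> ix jx; rewrite (_ : (fun u => _) = loc i (fun y => crd j y 0 l)).
  exact: A_diff.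
by apply/funext => u; rewrite mxE.
Qed.

Lemma change_crd i j x : dom i x -> dom j x ->
  \row_l loc i (fun y => crd j y 0 l) (crd i x) = crd j x.
Proof. by move=> ix jx; apply/rowP => l; rewrite mxE loc_crd. Qed.

Lemma diff_at_change i j f x : dom i x -> dom j x -> diff_at j f x -> diff_at i f x.
Proof.
move=> ix jx df; apply: near_eq_differentiable (change_near f ix jx) _.
apply: differentiable_comp; last by rewrite change_crd.
by apply: differentiable_row => l; exact: change_diff.
Qed.

Lemma pd_change i j f x k : dom i x -> dom j x -> diff_at j f x ->
  pd i k f x = \sum_l jac i j x k l * pd j l f x.
Proof.
move=> ix jx df; rewrite /pd -(near_eq_derive _ (change_near f ix jx)).
rewrite derive_comp; last 2 first.
- by move=> l; exact: change_diff.
- by rewrite change_crd.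
apply: eq_bigr => l _; rewrite change_crd// mxE; congr (_ * _).
rewrite (_ : (fun u => _) = loc i (fun y => crd j y 0 l)) //.
by apply/funext => u; rewrite mxE.
Qed.

Lemma jac_id i x : dom i x -> jac i i x = 1%:M.
Proof. by move=> ix; apply/matrixP => k l; rewrite !mxE pd_crd. Qed.

Lemma jac_comp i j j' x : dom i x -> dom j x -> dom j' x ->
  jac i j x *m jac j j' x = jac i j' x.
Proof.
move=> ix jx j'x; apply/matrixP => k l; rewrite !mxE (pd_change _ ix jx).
  by apply: eq_bigr => s _; rewrite !mxE.
exact: A_diff.
Qed.

Lemma jacK i j x : dom i x -> dom j x -> jac i j x *m jac j i x = 1%:M.
Proof. by move=> ix jx; rewrite jac_comp// jac_id. Qed.

Lemma loc_pd i k f u : img i u -> loc i (pd i k f) u = 'D_(delta_mx 0 k) (loc i f) u.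
Proof. by move=> [x ix <-]; rewrite loc_crd. Qed.

Lemma C_infty_pd (U : set 'rV[R]_m) i k f : open U -> U `<=` img i ->
  C_infty U (loc i f) -> C_infty U (loc i (pd i k f)).
Proof.
move=> oU Ui Cf s; have := C_infty_derive k Cf s; apply: C_eq => // u Uu.
by rewrite loc_pd//; exact: Ui.
Qed.

(** Stated for an open subset U of the image of the chart, and not only for smooth
    functions on the manifold, in order to apply to the coordinates of another
    chart, which are smooth on the overlap only. *)
Lemma pd_sym (U : set 'rV[R]_m) i k l f x : open U -> U `<=` img i ->
  C_infty U (loc i f) -> U (crd i x) ->
  pd i k (pd i l f) x = pd i l (pd i k f) x.
Proof.
move=> oU Ui Cf Ux.
have E s t : pd i s (pd i t f) x =
    'D_(delta_mx 0 s) (fun u => 'D_(delta_mx 0 t) (loc i f) u) (crd i x).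
  apply: near_eq_derive.
  by apply: (near_eq_in oU Ux) => u Uu; rewrite loc_pd//; exact: Ui.
by rewrite !E; exact: schwarz oU (Cf 2%N) Ux.
Qed.

Lemma smooth_diff_at i f x : smooth A f -> dom i x -> diff_at i f x.
Proof.
move=> sf ix; apply: C_infty_differentiable (sf i) _; by exists x.
Qed.

Lemma on_in (V : nmodType) (T : idx A -> N -> V) i x : dom i x -> on T i x = T i x.
Proof. by move=> ix; rewrite /on patchT// inE. Qed.

Lemma on_out (V : nmodType) (T : idx A -> N -> V) i x : ~ dom i x -> on T i x = 0.
Proof. by move=> ix; rewrite /on patchC// inE. Qed.

Lemma row_dot n (a b : 'rV[R]_n) : \sum_l a 0 l * b 0 l = (a *m b^T) 0 0.
Proof. by rewrite mxE; apply: eq_bigr => l _; rewrite mxE. Qed.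

(** The contravariant analogue is [vector_field_change]; the transpose is due to
    the components being rows. *)
Definition covector_change (alpha : idx A -> N -> 'rV[R]_m) := forall i j x,
  dom i x -> dom j x -> alpha i x = alpha j x *m (jac i j x)^T.

(** [pairing] picks an unspecified chart at each point, so it can be
    differentiated only once its value is known to be the same in all charts. *)
Lemma pairing_chart alpha X i x : covector_change alpha -> vector_field X ->
  dom i x -> pairing alpha X x = \sum_l alpha i x 0 l * X i x 0 l.
Proof.
move=> ac Xv ix; apply: xget_unique; first by exists i.
move=> _ [j jx <-]; rewrite !row_dot (ac i j)// (vector_field_change Xv ix jx).
by rewrite trmx_mul mulmxA.
Qed.

Lemma d0_change f : smooth A f -> covector_change (d0 f).
Proof.
move=> sf i j x ix jx; rewrite /d0 !on_in//; apply/rowP => k; rewrite !mxE.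
rewrite (pd_change _ ix jx); last exact: smooth_diff_at.
by apply: eq_bigr => l _; rewrite !mxE mulrC.
Qed.

Lemma lie0_chart X f i x : vector_field X -> smooth A f -> dom i x ->
  lie0 X f x = \sum_l pd i l f x * X i x 0 l.
Proof.
move=> Xv sf ix; rewrite /lie0 (pairing_chart (d0_change sf) Xv ix).
by apply: eq_bigr => l _; rewrite /d0 on_in// mxE.
Qed.

Lemma vector_field_diff X i x l : vector_field X -> dom i x ->
  diff_at i (fun y => X i y 0 l) x.
Proof.
move=> Xv ix; apply: C_infty_differentiable (vector_field_smooth Xv i l) _.
by exists x.
Qed.

(** Cartan's formula L_X alpha = d(alpha(X)) + i_X d alpha: by the Leibniz rule,
    d(alpha(X)) contributes X^s d_l alpha_s + alpha_s d_l X^s, and i_X d alpha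
    trades the first term for X^s d_s alpha_l. *)
Lemma cartan1 alpha X : covector_change alpha -> vector_field X ->
  (forall i l x, dom i x -> diff_at i (fun y => alpha i y 0 l) x) ->
  lie1 X alpha = d0 (pairing alpha X) + iprod X (d1 alpha).
Proof.
move=> ac Xv da; apply/funext => i; apply/funext => x; rewrite !fctE /iprod.
have [ix|nix] := pselect (dom i x); last first.
  by rewrite /lie1 /d0 /d1 !on_out// mulmx0 addr0.
rewrite /lie1 /d0 /d1 !on_in//; apply/rowP => l; rewrite !mxE.
rewrite (@eq_pd i l _ (fun y => \sum_s alpha i y 0 s * X i y 0 s)); last first.
  by move=> y iy; exact: pairing_chart.
rewrite pd_sumM// -?big_split /=; last 2 first.
- by move=> s; exact: da.
- by move=> s; exact: vector_field_diff.
by apply: eq_bigr => s _; rewrite !mxE; ring.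
Qed.

Lemma smooth_pairing alpha X : covector_change alpha -> vector_field X ->
  (forall i l, C_infty (img i) (loc i (fun x => alpha i x 0 l))) ->
  smooth A (pairing alpha X).
Proof.
move=> ac Xv sa i.
rewrite (@eq_loc i _ (fun y => \sum_l alpha i y 0 l * X i y 0 l)); last first.
  by move=> y iy; exact: pairing_chart.
rewrite loc_sumM; apply: C_infty_sum => [|l k]; first exact: img_open.
by apply: C_mul; [exact: img_open|exact: sa|exact: (vector_field_smooth Xv)].
Qed.

Lemma smoothN f : smooth A f -> smooth A (- f).
Proof. by move=> sf i k; rewrite locN; apply: C_opp; [exact: img_open|exact: sf]. Qed.

Lemma smoothB f g : smooth A f -> smooth A g -> smooth A (f - g).
Proof.
move=> sf sg i k; rewrite locB; apply: C_add; [exact: img_open|exact: sf|].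
by apply: C_opp; [exact: img_open|exact: sg].
Qed.

Lemma d0B f g : smooth A f -> smooth A g -> d0 (f - g) = d0 f - d0 g :> (idx A -> _).
Proof.
move=> sf sg; apply/funext => i; apply/funext => x; rewrite !fctE.
have [ix|nix] := pselect (dom i x); last by rewrite /d0 !on_out// subr0.
rewrite /d0 !on_in//; apply/rowP => l; rewrite !mxE pdB//; exact: smooth_diff_at.
Qed.

Lemma d0N f : smooth A f -> d0 (- f) = - d0 f :> (idx A -> _).
Proof.
move=> sf; apply/funext => i; apply/funext => x; rewrite !fctE.
have [ix|nix] := pselect (dom i x); last by rewrite /d0 !on_out// oppr0.
rewrite /d0 !on_in//; apply/rowP => l; rewrite !mxE pdN//; exact: smooth_diff_at.
Qed.

Lemma d1_d0 f : smooth A f -> d1 (d0 f : idx A -> _) = 0.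
Proof.
move=> sf; apply/funext => i; apply/funext => x.
have [ix|nix] := pselect (dom i x); last by rewrite /d1 on_out.
rewrite /d1 on_in//; apply/matrixP => k l; rewrite !mxE.
have E s : forall y, dom i y -> d0 f i y 0 s = pd i s f y.
  by move=> y iy; rewrite /d0 on_in// mxE.
rewrite (eq_pd _ _ (E l)) (eq_pd _ _ (E k)).
have ix' : img i (crd i x) by exists x.
by rewrite (pd_sym k l (@img_open i) (@subset_refl _ _) (sf i) ix') subrr.
Qed.

End atlas.

(** * The cotangent bundle without its zero section *)

Section cotangent_bundle.
Context {R : realType} {n : nat} {M : topologicalType} {A : charts R n M}.
Hypothesis A_manifold : smooth_manifold A.
Implicit Types (i j : idx A) (x : M) (a : slit A) (k l : 'I_n).

Lemma manifold_open_atlas : open_atlas A.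
Proof.
split=> [i|i j]; first exact: chart_inj A_manifold i.
apply: chart_open_map A_manifold _ _ _ _; last exact: subIsetl.
by apply: openI; exact: chart_dom_open A_manifold _.
Qed.
Let A_open := manifold_open_atlas.

Lemma manifold_transitions : differentiable_transitions A.
Proof.
move=> i j x l ix jx; apply: C_infty_differentiable (chart_smooth A_manifold i j l) _.
by exists x.
Qed.
Let A_diff := manifold_transitions.

Lemma overlap_img i j : crd i @` (dom i `&` dom j) `<=` img i.
Proof. by apply: image_subset; exact: subIsetl. Qed.

Lemma jac_diff_at i j i' k l x : dom i x -> dom j x -> dom i' x ->
  diff_at i' (fun y => jac i j y k l) x.
Proof.
move=> ix jx i'x; apply: (diff_at_change A_open A_diff i'x ix).
have -> : (fun y => jac i j y k l) = pd i k (fun y => crd j y 0 l).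
  by apply/funext => y; rewrite mxE.
have ijx : (crd i @` (dom i `&` dom j)) (crd i x) by exists x.
apply: C_infty_differentiable ijx.
exact: (C_infty_pd A_open k (atlas_open A_open i j) (@overlap_img i j)
  (chart_smooth A_manifold i j l)).
Qed.

(** The symmetry of the second derivatives of a change of coordinates. *)
Lemma jac_pd_sym i j k l l' x : dom i x -> dom j x ->
  pd i k (fun y => jac i j y l l') x = pd i l (fun y => jac i j y k l') x.
Proof.
move=> ix jx.
have E s : (fun y => jac i j y s l') = pd i s (fun y => crd j y 0 l').
  by apply/funext => y; rewrite mxE.
have ijx : (crd i @` (dom i `&` dom j)) (crd i x) by exists x.
rewrite !E; apply: (pd_sym A_open _ _ (atlas_open A_open i j) (@overlap_img i j) _ ijx).
exact: chart_smooth A_manifold i j l'.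
Qed.

(** The remaining fields of a covector are proofs, hence irrelevant. *)
Lemma cotangent_eq (a b : cotangent A) : base a = base b -> mom a = mom b -> a = b.
Proof.
case: a b => [x p po pc] [y q qo qc] /= xy pq; rewrite -{}xy in qo qc *.
by rewrite -{}pq in qo qc *; congr Cotangent; exact: Prop_irrelevance.
Qed.

Lemma mom_eq i (a b : cotangent A) : dom i (base a) -> base a = base b ->
  mom a i = mom b i -> a = b.
Proof.
move=> ia ab abi; apply: cotangent_eq => //; apply/funext => j.
have [ja|nja] := pselect (dom j (base a)); last by rewrite !mom_out// -ab.
by rewrite (mom_change ja ia) (@mom_change _ _ _ _ b j i) -?ab// abi.
Qed.

Lemma slit_mom_neq0 i a : dom i (base (sval a)) -> mom (sval a) i != 0.
Proof.
move=> ia; apply/negP => /eqP ai0; case: (svalP a); apply/funext => j.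
have [ja|nja] := pselect (dom j (base (sval a))); last by rewrite mom_out.
by rewrite (mom_change ja ia) ai0 mul0mx.
Qed.

(** The induced chart at i hits every nonzero momentum. The components in the
    other charts are forced by the transformation rule, and they are consistent
    because the Jacobian matrices of M satisfy the cocycle relation [jac_comp]. *)
Lemma slit_point i x (p : 'rV[R]_n) : dom i x -> p != 0 ->
  exists a, base (sval a) = x /\ mom (sval a) i = p.
Proof.
move=> ix p0; pose q j := if pselect (dom j x) then p *m (jac j i x)^T else 0.
have qE j : dom j x -> q j = p *m (jac j i x)^T by rewrite /q; case: pselect.
have q_out j : ~ dom j x -> q j = 0 by rewrite /q; case: pselect.
have q_change j j' : dom j x -> dom j' x -> q j = q j' *m (jac j j' x)^T.
  move=> jx j'x; rewrite (qE _ jx) (qE _ j'x) -mulmxA -trmx_mul.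
  by rewrite (jac_comp A_open A_diff jx j'x ix).
have qi : q i = p by rewrite qE// (jac_id A_open)// trmx1 mulmx1.
have a0 : ~ zero_section (Cotangent q_out q_change).
  by move=> /(congr1 (@^~ i)) /=; rewrite qi; exact/eqP.
by exists (exist (fun a : cotangent A => ~ zero_section a) _ a0).
Qed.

Local Notation S := (slit_charts A).

Lemma slit_img i (D : set M) : D `<=` dom i ->
  @crd _ _ _ S i @` [set a | D (base (sval a))] =
  [set u | (crd i @` D) (lsubmx u)] `&` [set u | rsubmx u != 0].
Proof.
move=> Di; apply/seteqP; split=> [_ [a Da <-]|u [[x Dx xu] u0]] /=.
  rewrite row_mxKl row_mxKr; split; first by exists (base (sval a)).
  exact/slit_mom_neq0/Di.
have [a [ax au]] := slit_point (Di _ Dx) u0.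
by exists a => /=; [rewrite ax|rewrite ax au xu hsubmxK].
Qed.

Lemma slit_open_atlas : open_atlas S.
Proof.
split=> [i a b|i j].
  rewrite !inE /= => ia ib /eq_row_mx[ab abi].
  have abE : base (sval a) = base (sval b).
    by apply: (atlas_inj A_open) ab; rewrite inE.
  have := mom_eq ia abE abi; case: a b {ia ib ab abi abE} => [a a0] [b b0] /= ab.
  by rewrite -{}ab in b0 *; congr exist; exact: Prop_irrelevance.
have -> : @dom _ _ _ S i `&` @dom _ _ _ S j =
  [set a : slit A | (@dom _ _ _ A i `&` @dom _ _ _ A j) (base (sval a))] by [].
rewrite slit_img; last exact: subIsetl.
apply: openI.
  apply: open_comp (atlas_open A_open i j) => u _; exact: continuous_lsubmx.
have -> : [set u : 'rV[R]_(n + n) | rsubmx u != 0] = rsubmx @^-1` (~` [set 0]).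
  by apply/seteqP; split=> u /= /eqP.
apply: open_comp => [u _|]; first exact: continuous_rsubmx.
exact/closed_openC/accessible_closed_set1/hausdorff_accessible/norm_hausdorff.
Qed.
Let S_open := slit_open_atlas.

Lemma slit_loc_base i f u : rsubmx u != 0 ->
  @loc _ _ _ S i (fun a => f (base (sval a))) u = loc i f (lsubmx u).
Proof.
move=> u0; have [[x ix xu]|iu] := pselect (img i (lsubmx u)).
  have [a [ax au]] := slit_point ix u0.
  have -> : u = @crd _ _ _ S i a by rewrite /= ax au xu hsubmxK.
  by rewrite (loc_crd S_open) /= ?row_mxKl ?(loc_crd A_open)//= ax.
rewrite !loc_out// => -[a ia au]; apply: iu; exists (base (sval a)) => //.
by rewrite -au /= row_mxKl.
Qed.

Lemma slit_near_base i f a : dom i (base (sval a)) ->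
  \forall u \near @crd _ _ _ S i a,
    (loc i f \o lsubmx) u = @loc _ _ _ S i (fun a => f (base (sval a))) u.
Proof.
move=> ia; apply: (overlap_near S_open (i := i) (j := i)) => // b ib _ /=.
by rewrite slit_loc_base// row_mxKr slit_mom_neq0.
Qed.

Lemma lsubmx_diff l (u : 'rV[R]_(n + n)) :
  differentiable (fun w : 'rV[R]_(n + n) => lsubmx w 0 l) u.
Proof.
rewrite (_ : (fun w => _) = (fun w : 'rV[R]_(n + n) => w 0 (lshift n l))).
  exact: differentiable_coord.
by apply/funext => w; rewrite mxE.
Qed.

Lemma slit_diff_base i f a : dom i (base (sval a)) ->
  diff_at i f (base (sval a)) ->
  @diff_at _ _ _ S i (fun a => f (base (sval a))) a.
Proof.
move=> ia df; apply: near_eq_differentiable (slit_near_base f ia) _.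
apply: differentiable_comp; first exact: differentiable_lsubmx.
by rewrite /= row_mxKl.
Qed.

(** A function of the base point has the expression f o pr_1 in an induced chart,
    where pr_1 is [lsubmx]. *)
Lemma slit_pd_base i f a s : dom i (base (sval a)) ->
  diff_at i f (base (sval a)) ->
  @pd _ _ _ S i s (fun a => f (base (sval a))) a =
  if fintype.split s is inl k then pd i k f (base (sval a)) else 0.
Proof.
move=> ia df; rewrite /pd -(near_eq_derive _ (slit_near_base f ia)).
rewrite derive_comp; last 2 first.
- by move=> l; exact: lsubmx_diff.
- by rewrite /= row_mxKl.
have E l : 'D_(delta_mx 0 s) (fun w : 'rV[R]_(n + n) => lsubmx w 0 l)
    (@crd _ _ _ S i a) = (s == lshift n l)%:R.
  rewrite (_ : (fun w => _) = (fun w : 'rV[R]_(n + n) => w 0 (lshift n l))).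
    by rewrite derive_coord mxE eqxx eq_sym.
  by apply/funext => w; rewrite mxE.
under eq_bigr do rewrite E.
case: split_ordP => k ->.
  rewrite (bigD1 k)//= big1 ?addr0 ?eqxx ?mul1r ?row_mxKl// => l lk.
  by rewrite (inj_eq (@lshift_inj _ _)) eq_sym (negPf lk) mul0r.
by rewrite big1// => l _; rewrite eq_rlshift mul0r.
Qed.

Lemma slit_pd_lbase i f a k : dom i (base (sval a)) ->
  diff_at i f (base (sval a)) ->
  @pd _ _ _ S i (lshift n k) (fun a => f (base (sval a))) a = pd i k f (base (sval a)).
Proof. by move=> ia df; rewrite slit_pd_base// (unsplitK (inl k)). Qed.

Lemma slit_pd_rbase i f a k : dom i (base (sval a)) ->
  diff_at i f (base (sval a)) ->
  @pd _ _ _ S i (rshift n k) (fun a => f (base (sval a))) a = 0.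
Proof. by move=> ia df; rewrite slit_pd_base// (unsplitK (inr k)). Qed.

Lemma slit_mom_diff i a k : dom i (base (sval a)) ->
  @diff_at _ _ _ S i (fun b => mom (sval b) i 0 k) a.
Proof.
move=> ia; have := @diff_at_crd _ _ _ _ S_open i (rshift n k) a ia.
by congr (@diff_at _ _ _ S i _ a); apply/funext => b; rewrite /= row_mxEr.
Qed.

Lemma slit_pd_mom i a s k : dom i (base (sval a)) ->
  @pd _ _ _ S i s (fun b => mom (sval b) i 0 k) a = (s == rshift n k)%:R.
Proof.
move=> ia; have <- := @pd_crd _ _ _ _ S_open i s (rshift n k) a ia.
by congr (@pd _ _ _ S i s _ a); apply/funext => b; rewrite /= row_mxEr.
Qed.

Lemma mom_sum i j a l : dom i (base (sval a)) -> dom j (base (sval a)) ->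
  mom (sval a) j 0 l = \sum_k mom (sval a) i 0 k * jac j i (base (sval a)) l k.
Proof.
by move=> ia ja; rewrite (mom_change ja ia) mxE; apply: eq_bigr => k _; rewrite mxE.
Qed.

(** The new momenta are products of the old momenta with the entries of a Jacobian
    matrix of M, which is differentiable in the base point. *)
Lemma slit_mom_change_diff i j a l : dom i (base (sval a)) ->
  dom j (base (sval a)) -> @diff_at _ _ _ S i (fun b => mom (sval b) j 0 l) a.
Proof.
move=> ia ja; apply: (overlap_diff_at S_open (i := i) (j := j)
  (f := fun b => \sum_k mom (sval b) i 0 k * jac j i (base (sval b)) l k)) => //.
  by move=> b ib jb; rewrite -mom_sum.
apply: (diff_at_sumM S_open) => k; first exact: slit_mom_diff.
by apply: (slit_diff_base (f := fun y => jac j i y l k)) => //; exact: jac_diff_at.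
Qed.

Lemma slit_transitions : differentiable_transitions S.
Proof.
move=> i j a s ia ja; case: (split_ordP s) => l ->.
  rewrite (_ : (fun b => _) = fun b : slit A => @crd _ _ _ A j (base (sval b)) 0 l).
    apply: (slit_diff_base (f := fun y => @crd _ _ _ A j y 0 l)) => //.
    exact: A_diff.
  by apply/funext => b; rewrite /= row_mxEl.
rewrite (_ : (fun b => _) = fun b : slit A => mom (sval b) j 0 l).
  exact: slit_mom_change_diff.
by apply/funext => b; rewrite /= row_mxEr.
Qed.

(** With coordinates (x, p) in the chart i and (y, q) in the chart j, the new
    momenta are q_l = p_k dx^k/dy^l, whence the diagonal blocks. The relation on
    the block B = dq/dx comes from differentiating p_m = q_l dy^l/dx^m with respect
    to x^k: B_kl dy^l/dx^m = - q_l d^2 y^l/(dx^k dx^m) is symmetric in k and m. *)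
Lemma slit_jac i j a : dom i (base (sval a)) -> dom j (base (sval a)) ->
  exists2 B : 'M[R]_n,
    @jac _ _ _ S i j a =
      block_mx (jac i j (base (sval a))) B 0 (jac j i (base (sval a)))^T &
    B *m (jac i j (base (sval a)))^T = jac i j (base (sval a)) *m B^T.
Proof.
move=> ia ja; pose B := \matrix_(k, l)
  @pd _ _ _ S i (lshift n k) (fun b => mom (sval b) j 0 l) a.
have crdl l : (fun b => @crd _ _ _ S j b 0 (lshift n l)) =
    fun b => crd j (base (sval b)) 0 l by apply/funext => b; rewrite /= row_mxEl.
have crdr l : (fun b => @crd _ _ _ S j b 0 (rshift n l)) =
    fun b => mom (sval b) j 0 l by apply/funext => b; rewrite /= row_mxEr.
have dJ l k : @diff_at _ _ _ S i (fun b => jac j i (base (sval b)) l k) a.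
  by apply: (slit_diff_base (f := fun y => jac j i y l k)) => //; exact: jac_diff_at.
have dJ' l k : @diff_at _ _ _ S i (fun b => jac i j (base (sval b)) l k) a.
  by apply: (slit_diff_base (f := fun y => jac i j y l k)) => //; exact: jac_diff_at.
exists B.
  rewrite -[LHS]submxK; congr block_mx; apply/matrixP => k l; rewrite !mxE.
  - rewrite crdl (slit_pd_lbase (f := fun y => crd j y 0 l))//.
    exact: A_diff.
  - by rewrite crdr.
  - rewrite crdl (slit_pd_rbase (f := fun y => crd j y 0 l))//.
    exact: A_diff.
  - rewrite crdr (@overlap_pd _ _ _ _ S_open i j (rshift n k) _ (fun b =>
      \sum_s mom (sval b) i 0 s * jac j i (base (sval b)) l s))//; last first.
      by move=> b ib jb; rewrite -mom_sum.
    rewrite (pd_sumM S_open _ ia (fun s => slit_mom_diff s ia) (dJ l)).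
    rewrite (bigD1 k)//= big1 ?addr0 => [|s sk].
      rewrite slit_pd_mom// eqxx mul1r (slit_pd_rbase (f := fun y => jac j i y l k))//.
        by rewrite mulr0 addr0 mxE.
      exact: jac_diff_at.
    rewrite slit_pd_mom// (inj_eq (@rshift_inj _ _)) eq_sym (negPf sk) mul0r add0r.
    rewrite (slit_pd_rbase (f := fun y => jac j i y l s)) ?mulr0//.
    exact: jac_diff_at.
have E k m : (B *m (jac i j (base (sval a)))^T) k m =
    - \sum_l mom (sval a) j 0 l * pd i k (fun y => jac i j y m l) (base (sval a)).
  have : @pd _ _ _ S i (lshift n k) (fun b => mom (sval b) i 0 m) a = 0.
    by rewrite slit_pd_mom// eq_lrshift.
  rewrite (@overlap_pd _ _ _ _ S_open i j (lshift n k) _ (fun b =>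
    \sum_s mom (sval b) j 0 s * jac i j (base (sval b)) m s))//; last first.
    by move=> b ib jb; rewrite -mom_sum.
  rewrite (pd_sumM S_open _ ia (fun s => slit_mom_change_diff s ia ja) (dJ' m)).
  rewrite big_split /= => /eqP; rewrite addr_eq0 => /eqP E.
  transitivity (\sum_s @pd _ _ _ S i (lshift n k) (fun b => mom (sval b) j 0 s) a *
    jac i j (base (sval a)) m s).
    by rewrite mxE; apply: eq_bigr => s _; rewrite !mxE.
  rewrite E; congr (- _); apply: eq_bigr => s _; congr (_ * _).
  rewrite (slit_pd_lbase (f := fun y => jac i j y m s))//.
  exact: jac_diff_at.
rewrite -[RHS]trmxK trmx_mul trmxK; apply/matrixP => k m; rewrite [RHS]mxE !E.
by congr (- _); apply: eq_bigr => l _; rewrite jac_pd_sym.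
Qed.

End cotangent_bundle.

(** * Symplectic geometry in canonical coordinates *)

Section symplectic_geometry.
Context {R : realType} {n : nat} {M : topologicalType} {A : charts R n M}.
Hypothesis A_manifold : smooth_manifold A.
Local Notation S := (slit_charts A).
Implicit Types (i j : idx S) (a : slit A) (f h : slit A -> R).
Implicit Types (X : idx S -> slit A -> 'rV[R]_(n + n)).
Let S_open := slit_open_atlas A_manifold.
Let S_diff := slit_transitions A_manifold.

(** The matrix of dp_k /\ dx^k in the coordinates (x, p). *)
Definition darboux : 'M[R]_(n + n) := block_mx 0 (- 1%:M) 1%:M 0.

Lemma darboux_sq : darboux *m darboux = - 1%:M.
Proof.
rewrite /darboux mulmx_block !mul0mx !mulmx0 !mulNmx !mulmxN !mul1mx.
by rewrite !add0r !addr0 scalar_mx_block opp_block_mx !oppr0.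
Qed.

Lemma trmx_darboux : darboux^T = - darboux.
Proof.
by rewrite /darboux tr_block_mx opp_block_mx !trmx0 linearN /= trmx1 opprK !oppr0.
Qed.

(** Changes of canonical coordinates are canonical transformations: the diagonal
    blocks of the Jacobian matrix are mutually inverse up to transposition, and the
    symmetry in [slit_jac] cancels the remaining block. *)
Lemma jac_symplectic i j a : dom i a -> dom j a ->
  jac i j a *m darboux *m (jac i j a)^T = darboux.
Proof.
move=> ia ja; have [B -> BE] := slit_jac A_manifold ia ja.
have JK := jacK (manifold_open_atlas A_manifold) (manifold_transitions A_manifold) ia ja.
rewrite /darboux tr_block_mx trmxK trmx0 !mulmx_block.
rewrite !(mulmx0, mul0mx, mulmx1, mulmxN, mulNmx, add0r, addr0) JK BE subrr.
by rewrite -trmx_mul JK trmx1.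
Qed.

(** The inverse of a symplectic matrix is symplectic: J Omega J^T = Omega and
    Omega^2 = - 1 make J Omega and - J^T Omega mutually inverse. *)
Lemma jac_symplectic_tr i j a : dom i a -> dom j a ->
  (jac i j a)^T *m darboux *m jac i j a = darboux.
Proof.
move=> ia ja; set J := jac i j a.
have JE : J *m darboux *m J^T = darboux by exact: jac_symplectic.
have /mulmx1C : (J *m darboux) *m - (J^T *m darboux) = 1%:M.
  by rewrite mulmxN mulmxA JE darboux_sq opprK.
rewrite mulNmx mulmxA => /(congr1 (mulmxr darboux)) /=.
by rewrite mulNmx -(mulmxA (_ *m J)) darboux_sq mulmxN mulmx1 opprK mul1mx.
Qed.

Lemma liouville_change : covector_change (theta_[A]).
Proof.
move=> i j a ia ja; rewrite /liouville !on_in//.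
have [B -> _] := slit_jac A_manifold ia ja.
by rewrite tr_block_mx mul_row_block !mul0mx !addr0 (mom_change ia ja) trmx0 mulmx0.
Qed.

Lemma liouville_coord i a (l : 'I_n) : dom i a ->
  theta_[A] i a 0 (lshift n l) = @crd _ _ _ S i a 0 (rshift n l).
Proof. by move=> ia; rewrite /liouville on_in// row_mxEl /= row_mxEr. Qed.

Lemma liouville_0 i a (l : 'I_n) : theta_[A] i a 0 (rshift n l) = 0.
Proof.
rewrite /liouville; have [ia|nia] := pselect (dom i a); last by rewrite on_out ?mxE.
by rewrite on_in// row_mxEr mxE.
Qed.

Lemma liouville_smooth i s : C_infty (img i) (loc i (fun a => theta_[A] i a 0 s)).
Proof.
have oi := @img_open _ _ _ _ S_open i.
case: (split_ordP s) => l -> k.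
  apply: (C_eq oi _ (C_coord oi k (rshift n l))) => _ [a ia <-].
  by rewrite (loc_crd S_open)// liouville_coord.
apply: (C_eq oi _ (@C_const _ _ _ k 0)) => _ [a ia <-].
by rewrite (loc_crd S_open)// liouville_0.
Qed.

Lemma symplecticE i a : dom i a -> omega_[A] i a = darboux.
Proof.
move=> ia; rewrite /symplectic /d1 on_in//; apply/matrixP => s t; rewrite mxE.
have E u v : pd i u (fun y => theta_[A] i y 0 v) a =
    if fintype.split v is inl l then (u == rshift n l)%:R else 0.
  case: split_ordP => l ->.
    rewrite (eq_pd S_open _ _ (fun b => @liouville_coord i b l)).
    by rewrite (pd_crd S_open).
  rewrite -(pd_cst S_open u 0 ia); apply: (eq_pd S_open) => b _.
  exact: liouville_0.
rewrite !E /darboux; case: (split_ordP s) => k ->; case: (split_ordP t) => l ->;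
  rewrite ?(unsplitK (inl k)) ?(unsplitK (inr k)).
- by rewrite block_mxEul !eq_lrshift subrr mxE.
- by rewrite block_mxEur (inj_eq (@rshift_inj _ _)) sub0r !mxE eq_sym.
- by rewrite block_mxEdl (inj_eq (@rshift_inj _ _)) subr0 !mxE.
- by rewrite block_mxEdr subrr mxE.
Qed.

(** The solution X of X Omega = - df, as Omega^2 = - 1; for a Hamiltonian it is the
    Hamiltonian vector field. *)
Definition symplectic_gradient f : idx S -> slit A -> 'rV[R]_(n + n) :=
  fun i a => d0 f i a *m darboux.

Lemma symplectic_gradientE f i a : dom i a ->
  symplectic_gradient f i a =
  row_mx (\row_k pd i (rshift n k) f a) (\row_k - pd i (lshift n k) f a).
Proof.
move=> ia; rewrite /symplectic_gradient /d0 on_in// -[X in X *m _]hsubmxK.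
rewrite mul_row_block !mulmx0 add0r addr0 mulmx1 mulmxN mulmx1.
by congr row_mx; apply/rowP => k; rewrite !mxE.
Qed.

Lemma hamiltonian_fieldE (H : cotangent A -> R) :
  hamiltonian_field H = symplectic_gradient (slit_restr H).
Proof.
apply/funext => i; apply/funext => a; rewrite /hamiltonian_field.
have [ia|nia] := pselect (dom i a); first by rewrite on_in// symplectic_gradientE.
by rewrite /symplectic_gradient /d0 !on_out// mul0mx.
Qed.

(** The change of coordinates of df followed by Omega is that of a vector field
    exactly because the Jacobian matrices are symplectic. *)
Lemma symplectic_gradient_vector_field f : smooth S f ->
  vector_field (symplectic_gradient f).
Proof.
move=> sf; split=> [i a nia|i j a ia ja|i s k].
- by rewrite /symplectic_gradient /d0 on_out// mul0mx.
- rewrite /symplectic_gradient (d0_change S_open S_diff sf ia ja) -!mulmxA.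
  by rewrite (mulmxA _^T) jac_symplectic_tr.
- have oi := @img_open _ _ _ _ S_open i.
  have Cpd u : C_infty (img i) (loc i (pd i u f)).
    exact: (C_infty_pd S_open u oi (@subset_refl _ _) (sf i)).
  case: (split_ordP s) => l ->.
    rewrite (eq_loc S_open (g := pd i (rshift n l) f)); first exact: Cpd.
    by move=> a ia; rewrite symplectic_gradientE// row_mxEl mxE.
  rewrite (eq_loc S_open (g := - pd i (lshift n l) f)) ?(locN S_open).
    exact: (C_opp oi (Cpd _ k)).
  by move=> a ia; rewrite symplectic_gradientE// row_mxEr mxE.
Qed.

Lemma iprod_gradient f : iprod (symplectic_gradient f) omega_[A] = - d0 f.
Proof.
apply/funext => i; apply/funext => a; rewrite /iprod -[RHS]/(- d0 f i a).
have [ia|nia] := pselect (dom i a).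
  by rewrite symplecticE// /symplectic_gradient -mulmxA darboux_sq mulmxN mulmx1.
by rewrite /symplectic_gradient /d0 on_out// !mul0mx oppr0.
Qed.

Lemma iprod_inj X Y : vector_field X -> vector_field Y ->
  iprod X omega_[A] = iprod Y omega_[A] -> X = Y.
Proof.
move=> Xv Yv XY; apply/funext => i; apply/funext => a.
have [ia|nia] := pselect (dom i a); last by rewrite !(vector_field_out _ nia).
have := congr1 (fun T => T i a *m darboux) XY; rewrite /iprod symplecticE//.
by rewrite -!mulmxA darboux_sq !mulmxN !mulmx1 => /oppr_inj.
Qed.

(** Cartan's formula for the closed form omega; as its components are constant, the
    terms left in the Lie derivative are those of d(i_X omega), by antisymmetry. *)
Lemma lie2_symplectic X : vector_field X ->
  lie2 X omega_[A] = d1 (iprod X omega_[A]).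
Proof.
move=> Xv; apply/funext => i; apply/funext => a.
have [ia|nia] := pselect (dom i a); last by rewrite /lie2 /d1 !on_out.
rewrite /lie2 /d1 !on_in//; apply/matrixP => k l; rewrite !mxE.
have iE s t : pd i s (fun b => iprod X omega_[A] i b 0 t) a =
    \sum_u pd i s (fun b => X i b 0 u) a * darboux u t.
  rewrite (@eq_pd _ _ _ _ S_open i s _ (fun b => \sum_u X i b 0 u * darboux u t)).
    rewrite (pd_sumM S_open s ia (fun u => vector_field_diff u Xv ia)
      (fun u => diff_at_cst S_open (darboux u t) ia)).
    by apply: eq_bigr => u _; rewrite (pd_cst S_open)// mulr0 addr0.
  by move=> b ib; rewrite /iprod symplecticE// mxE.
rewrite !iE -sumrB; apply: eq_bigr => s _.
rewrite (@eq_pd _ _ _ _ S_open i s _ (fun=> darboux k l)); last first.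
  by move=> b ib; rewrite symplecticE.
rewrite (pd_cst S_open)// mulr0 add0r !symplecticE//.
have /matrixP/(_ s k) := trmx_darboux; rewrite [LHS]mxE [RHS]mxE => ->.
by rewrite mulNr mulrC [X in _ - X]mulrC.
Qed.

Lemma slit_chart_cover a : exists i, dom i a.
Proof. exact: chart_cover A_manifold (base (sval a)). Qed.

(** Both sides are omega(X, rho), where rho is the symplectic gradient of f:
    dh = i_X omega gives the left one and i_rho omega = - df the right one. *)
Lemma lie0_hamiltonian X f h : vector_field X -> smooth S f -> smooth S h ->
  iprod X omega_[A] = d0 h -> lie0 (symplectic_gradient f) h = lie0 X f.
Proof.
move=> Xv sf sh Xh; apply/funext => a.
have [i ia] := slit_chart_cover a.
have gv := symplectic_gradient_vector_field sf.
rewrite (lie0_chart S_open S_diff gv sh ia).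
rewrite (lie0_chart S_open S_diff Xv sf ia).
have d0E (g : slit A -> R) l : pd i l g a = d0 g i a 0 l.
  by rewrite /d0 on_in// mxE.
under eq_bigr do rewrite d0E; under [RHS]eq_bigr do rewrite d0E.
rewrite !row_dot -Xh /iprod symplecticE// /symplectic_gradient trmx_mul trmx_darboux.
rewrite mulNmx mulmxN mulmxA -(mulmxA (X i a)) darboux_sq mulmxN mulmx1 mulNmx opprK.
by rewrite -[X in X *m (d0 f i a)^T]trmxK -trmx_mul mxE.
Qed.

Lemma lie0N X f : vector_field X -> smooth S f -> lie0 X (- f) = - lie0 X f.
Proof.
move=> Xv sf; apply/funext => a; rewrite -[RHS]/(- lie0 X f a).
have [i ia] := slit_chart_cover a.
rewrite (lie0_chart S_open S_diff Xv (smoothN S_open sf) ia).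
rewrite (lie0_chart S_open S_diff Xv sf ia) -sumrN.
apply: eq_bigr => l _; rewrite (pdN S_open) ?mulNr//.
exact: smooth_diff_at sf ia.
Qed.

Lemma lie1_liouville X : vector_field X ->
  lie1 X theta_[A] = d0 (pairing theta_[A] X) + iprod X omega_[A].
Proof.
move=> Xv; apply: (cartan1 S_open liouville_change Xv) => i s a ia.
by apply: C_infty_differentiable (liouville_smooth i s) _; exists a.
Qed.

Lemma smooth_liouville_pairing X : vector_field X -> smooth S (pairing theta_[A] X).
Proof.
move=> Xv; apply: (smooth_pairing S_open liouville_change Xv) => i l.
exact: liouville_smooth.
Qed.

End symplectic_geometry.

(** * Noether symmetries and conservation laws *)

Theorem theorem3 (R : realType) (n : nat) (M : topologicalType)
    (A : charts R n M) (H : cotangent A -> R)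
    (M_manifold : smooth_manifold A) (H_hamilton : hamilton_space H) :
  (forall (X : idx (slit_charts A) -> slit A -> 'rV[R]_(n + n))
          (f : slit A -> R),
     exact_noether_symmetry H X -> smooth (slit_charts A) f ->
     lie1 X theta_[A] = d0 f ->
     conservation_law H (f - pairing theta_[A] X)) /\
  (forall f : slit A -> R, conservation_law H f ->
     exists X : idx (slit_charts A) -> slit A -> 'rV[R]_(n + n),
       unique (fun Y => vector_field Y /\ iprod Y omega_[A] = - d0 f) X /\
       exact_noether_symmetry H X).
Proof.
have S_open := slit_open_atlas M_manifold.
have sH := hamilton_smooth H_hamilton.
split=> [X f [[Xv _ XH] _] sf XT|f [sf fH]].
  have sX := smooth_liouville_pairing M_manifold Xv.
  have sh : smooth (slit_charts A) (f - pairing theta_[A] X) by exact: smoothB.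
  split=> //; rewrite hamiltonian_fieldE (lie0_hamiltonian M_manifold Xv sH sh) //.
  by rewrite (d0B S_open sf sX) -XT (lie1_liouville M_manifold Xv) addrC addKr.
pose X := symplectic_gradient f.
have Xv : vector_field X by exact: symplectic_gradient_vector_field.
have Xi : iprod X omega_[A] = - d0 f by exact: iprod_gradient.
have sNf := smoothN S_open sf.
have Xdf : iprod X omega_[A] = d0 (- f) by rewrite Xi (d0N S_open sf).
exists X; split; first split=> [|Y [Yv Yi]]; first by [].
  by apply: (iprod_inj M_manifold Xv Yv); rewrite Xi Yi.
split; first split=> //.
- by rewrite (lie2_symplectic M_manifold Xv) Xdf d1_d0.
- rewrite -(lie0_hamiltonian M_manifold Xv sH sNf Xdf) -hamiltonian_fieldE.
  rewrite (lie0N M_manifold) ?fH ?oppr0//.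
  by rewrite hamiltonian_fieldE; exact: symplectic_gradient_vector_field.
have sX := smooth_liouville_pairing M_manifold Xv.
exists (pairing theta_[A] X - f); first exact: smoothB.
by rewrite (d0B S_open sX sf) (lie1_liouville M_manifold Xv) Xi.
Qed.
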